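(* Let $\mathcal A$ be a full rank supersolvable arrangement of lines in the real projective plane $\mathbb P^2_{\mathbb R}$. Then $\lvert Sing_2(\mathcal A)\rvert\geq \frac{\lvert\mathcal A\rvert}{2}$.
   Context: A line arrangement $\mathcal A=\{\ell_1,\dots,\ell_n\}$ in $\mathbb P^2$ over a field $\mathbb K$ is a finite set of distinct lines, defined by linear forms $\ell_i\in\mathbb K[x,y,z]$; it has full rank if $\dim_{\mathbb K}\mathrm{Span}(\ell_1,\dots,\ell_n)=3$. $Sing(\mathcal A)$ is the set of points lying on at least two lines of $\mathcal A$; the multiplicity of $Q\in Sing(\mathcal A)$ is the number of lines of $\mathcal A$ through $Q$. $Sing_2(\mathcal A)$ is the set of points of $Sing(\mathcal A)$ of multiplicity exactly $2$. A point $P\in Sing(\mathcal A)$ is modular if for every other $Q\in Sing(\mathcal A)$ the line through $P$ and $Q$ belongs to $\mathcal A$; $\mathcal A$ is supersolvable if it has a modular point. *)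

(* Defs.v *)
From HB Require Import structures.
From mathcomp Require Import all_boot all_order all_algebra.
From mathcomp Require Import finmap.
From mathcomp Require Import boolp classical_sets cardinality reals.

Set Implicit Arguments.
Unset Strict Implicit.
Unset Printing Implicit Defensive.

Import GRing.Theory.

Local Open Scope ring_scope.
Local Open Scope classical_set_scope.

(* A point of P^2 over K is a one-dimensional subspace of K^3. *)
Record point (K : fieldType) := Point {
  point_space :> {vspace 'cV[K]_3};
  point_dim : \dim point_space == 1%N
}.

HB.instance Definition _ (K : fieldType) := [isSub for @point_space K].
HB.instance Definition _ (K : fieldType) := [Choice of point K by <:].

(* The row (a, b, c) is the linear form a x + b y + c z; the projective line
   it defines is identified with the plane a x + b y + c z = 0 of K^3. *)
Definition form_line (K : fieldType) (l : 'rV[K]_3) : {vspace 'cV[K]_3} :=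
  lker (linfun (mulmx l : 'cV[K]_3 -> 'cV[K]_1)).

Record arrangement (K : fieldType) := Arrangement {
  nlines : nat;
  form : 'I_nlines -> 'rV[K]_3;
  form_neq0 : forall i, form i != 0;
  form_line_inj : injective (fun i => form_line (form i))
}.

Arguments form {K} a i.

Section Arrangement.
Variables (K : fieldType) (A : arrangement K).

Definition full_rank : Prop :=
  \dim <<[seq form A i | i <- enum 'I_(nlines A)]>> = 3%N.

Definition lies_on (p : point K) (L : {vspace 'cV[K]_3}) : bool :=
  (p <= L)%VS.

Definition in_arrangement (L : {vspace 'cV[K]_3}) : Prop :=
  exists i, form_line (form A i) = L.

Definition multiplicity (p : point K) : nat :=
  #|[pred i | lies_on p (form_line (form A i))]|.

Definition Sing : set (point K) := [set p | (2 <= multiplicity p)%N].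

Definition Sing2 : set (point K) :=
  [set p | Sing p /\ multiplicity p = 2%N].

(* For p != q, the line through them is the sum of the two subspaces. *)
Definition modular (p : point K) : Prop :=
  Sing p /\
  forall q, Sing q -> q != p -> in_arrangement (p + q)%VS.

Definition supersolvable : Prop := exists p, modular p.

End Arrangement.

(* Main.v *)
Require Import Defs.
From mathcomp Require Import all_boot all_order all_algebra.
From mathcomp Require Import zify lra.

(* Let P be a modular point, V the m lines through P and D the k other lines.
   Send P to the vertical point at infinity and one line of V to infinity, so
   that V consists of vertical lines and D of graphs of affine functions, any
   two of which agree on some v in V (parallel graphs agree at infinity).  For v
   in V let b_v be the number of distinct values on v of the graphs, and s_v the
   number of graphs whose value on v is taken only once; each of the latter
   gives a double point, so it is enough to bound T = sum_v s_v from below.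

   Two cyclically consecutive lines v, v' of V have no crossing between them,
   hence the k pairs of values on (v, v') form a chain in a product of chains of
   sizes b_v and b_v', and k + 1 <= b_v + b_v'.  Summing, m (k + 1) <= 2 sum b_v.
   Since 2 b_v <= s_v + k, this gives m <= T.  In particular some graph l is
   isolated on some v; as every other graph agrees with l on one of the other
   m - 1 lines, and a value shared by r >= 2 graphs on v satisfies
   r - 2 + 2 b_v <= s_v + k, also k <= T.  Therefore m + k <= 2 T. *)

Set Implicit Arguments.
Unset Strict Implicit.
Unset Printing Implicit Defensive.

Import Order.TTheory GRing.Theory Num.Theory.

Local Open Scope nat_scope.

(** * Values, fibers and isolated elements of a function on a finite set *)

Section Fibers.
Variables (T : finType) (rT : eqType) (D : {set T}) (f : T -> rT).

Definition values : seq rT := undup [seq f x | x in D].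
Definition fiber (c : rT) : {set T} := [set x in D | f x == c].
Definition isolated : {set T} := [set x in D | #|fiber (f x)| == 1].

Lemma mem_values x : x \in D -> f x \in values.
Proof. by move=> xD; rewrite mem_undup; apply: image_f. Qed.

Lemma fiber_gt0 c : c \in values -> 0 < #|fiber c|.
Proof.
rewrite mem_undup => /imageP[x xD ->].
by apply/card_gt0P; exists x; rewrite inE xD eqxx.
Qed.

Lemma sum_fibers (F : rT -> nat) :
  \sum_(x in D) F (f x) = \sum_(c <- values) #|fiber c| * F c.
Proof.
transitivity (\sum_(x in D) \sum_(c <- values) (f x == c) * F c).
  apply: eq_bigr => x xD.
  rewrite (bigD1_seq (f x)) ?mem_values ?undup_uniq //= eqxx mul1n.
  by rewrite big1 ?addn0 // => c; rewrite eq_sym => /negPf->.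
rewrite exchange_big /=; apply: eq_bigr => c _.
rewrite -big_distrl /= -sum1_card; congr (_ * _).
rewrite big_mkcond [RHS]big_mkcond /=; apply: eq_bigr => x _.
by rewrite inE; case: (x \in D); case: (f x == c).
Qed.

Lemma card_fibers : #|D| = \sum_(c <- values) #|fiber c|.
Proof.
rewrite -sum1_card (sum_fibers (fun=> 1)).
by apply: eq_bigr => c _; rewrite muln1.
Qed.

Lemma card_isolated : #|isolated| = \sum_(c <- values) (#|fiber c| == 1).
Proof.
transitivity (\sum_(x in D) (#|fiber (f x)| == 1)).
  rewrite -sum1_card big_mkcond [RHS]big_mkcond /=; apply: eq_bigr => x _.
  by rewrite inE; case: (x \in D); case: (_ == 1).
rewrite (sum_fibers (fun c => (#|fiber c| == 1 : nat))).
by apply: eq_bigr => c _; case: eqP => [->|]; rewrite ?muln0.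
Qed.

(** Holds value by value: a fiber of size [r >= 1] satisfies [2 <= (r == 1) + r]. *)
Lemma double_values_le : 2 * size values <= #|isolated| + #|D|.
Proof.
rewrite card_fibers card_isolated -big_split /= -sum1_size big_distrr /=.
rewrite big_seq [X in _ <= X]big_seq; apply: leq_sum => c /fiber_gt0.
lia.
Qed.

(** Keeps the slack [r - 2] that the previous bound loses on the fiber of [f x], of size
    [r >= 2]. *)
Lemma fiber_double_values_le x : x \in D -> 1 < #|fiber (f x)| ->
  #|fiber (f x)| + 2 * size values <= #|isolated| + #|D| + 2.
Proof.
move=> xD f2; rewrite card_fibers card_isolated -big_split /=.
rewrite -sum1_size big_distrr /=.
rewrite !(bigD1_seq (f x)) ?mem_values ?undup_uniq //=.
set u := \sum_(c <- _ | _) _; set v := \sum_(c <- _ | _) _.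
suff : u <= v by lia.
rewrite /u /v big_seq_cond [X in _ <= X]big_seq_cond.
by apply: leq_sum => c /andP[/fiber_gt0 + _]; lia.
Qed.

End Fibers.

Lemma size_values_inj (T : finType) (rT sT : eqType) (D : {set T})
    (f : T -> rT) (h : rT -> sT) :
  injective h -> size (values D (h \o f)) = size (values D f).
Proof.
move=> hI; rewrite /values; have -> : [seq (h \o f) x | x in D] = map h [seq f x | x in D].
  by rewrite /image_mem -map_comp.
by rewrite undup_map_inj // size_map.
Qed.

(** * Chains in a product of two chains *)

Lemma count_ltr_lt (R : realDomainType) (s : seq R) (x y : R) :
  x \in s -> (x < y)%R -> count (< x)%R s < count (< y)%R s.
Proof.
move=> xs xy; have := count_predUI (< x)%R (pred1 x) s.
rewrite (_ : count (predI _ _) s = 0) ?addn0; last first.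
  apply/eqP; rewrite -leqn0 leqNgt -has_count; apply/hasPn => z _ /=.
  by apply/negP => /andP[zx /eqP zE]; rewrite zE ltxx in zx.
have x_gt0 : 0 < count_mem x s by rewrite -has_count has_pred1.
move=> e; apply: (@leq_trans (count (predU (< x)%R (pred1 x)) s)).
  by rewrite e -addn1 leq_add2l.
by apply: sub_count => z /= /orP[zx|/eqP->//]; apply: lt_trans xy.
Qed.

(* Points in increasing position: the sum of the ranks of the two coordinates
   is injective. *)
Lemma card_chain_le (R : realDomainType) (T : finType) (D : {set T}) (f g : T -> R) :
    D != set0 ->
    {in D &, forall x y, (f x < f y -> g x <= g y)%R} ->
    {in D &, forall x y, f x = f y -> g x = g y -> x = y} ->
  #|D| + 1 <= size (values D f) + size (values D g).
Proof.
move=> /set0Pn[x0 x0D] fg fg_inj.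
have rank_lt (h : T -> R) x : x \in D ->
    count (< h x)%R (values D h) < size (values D h).
  move=> xD; rewrite -(count_predC (< h x)%R) -[X in X < _]addn0 ltn_add2l.
  by rewrite -has_count; apply/hasP; exists (h x); rewrite ?mem_values //= ltxx.
pose r x := count (< f x)%R (values D f) + count (< g x)%R (values D g).
(* The two ranks start at 0, so their sum is at most the sum of the sizes minus 2 and takes at most
   [N] values. *)
pose N := size (values D f) + size (values D g) - 1.
have rN x : x \in D -> r x < N.
  move=> xD; have := rank_lt f _ xD; have := rank_lt g _ xD.
  rewrite /r /N; lia.
have rlt x y : x \in D -> y \in D -> (f x < f y)%R -> r x < r y.
  move=> xD yD fxy; have := count_ltr_lt (mem_values f xD) fxy.
  suff : count (< g x)%R (values D g) <= count (< g y)%R (values D g).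
    by rewrite /r; lia.
  by apply: sub_count => z /= /lt_le_trans; apply; apply: fg.
have rlt2 x y : x \in D -> f x = f y -> (g x < g y)%R -> r x < r y.
  by move=> xD fxy /(count_ltr_lt (mem_values g xD)); rewrite /r fxy; lia.
have rI : {in D &, injective r}.
  move=> x y xD yD rxy; case: (ltgtP (f x) (f y)) => fxy.
  - by have := rlt _ _ xD yD fxy; rewrite rxy ltnn.
  - by have := rlt _ _ yD xD fxy; rewrite rxy ltnn.
  - case: (ltgtP (g x) (g y)) => gxy.
    + by have := rlt2 _ _ xD fxy gxy; rewrite rxy ltnn.
    + by have := rlt2 _ _ yD (esym fxy) gxy; rewrite rxy ltnn.
    + exact: fg_inj.
(* The element [x0] makes [values D f] nonempty, so the subtraction in [N] is not truncated. *)
suff : #|D| <= N by have := rank_lt f _ x0D; rewrite /N; lia.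
rewrite cardE -(size_map r) -(size_iota 0 N); apply: uniq_leq_size.
  by rewrite map_inj_in_uniq ?enum_uniq // => x y; rewrite !mem_enum; apply: rI.
by move=> _ /mapP[x + ->]; rewrite mem_enum mem_iota => /rN.
Qed.

(** * Lower bounds for the total number of isolated elements *)

Section Counting.
Variables (I T : finType) (rT : eqType) (V : {set I}) (D : {set T}).
Variable g : I -> T -> rT.
Hypothesis values_ge :
  #|V| * (#|D| + 1) <= 2 * \sum_(v in V) size (values D (g v)).

Lemma card_le_isolated : #|V| <= \sum_(v in V) #|isolated D (g v)|.
Proof.
have : \sum_(v in V) 2 * size (values D (g v)) <=
       \sum_(v in V) (#|isolated D (g v)| + #|D|).
  by apply: leq_sum => v _; apply: double_values_le.
rewrite -big_distrr big_split /= sum_nat_const; lia.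
Qed.

Hypothesis V_neq0 : V != set0.
Hypothesis D_meet : {in D &, forall x y, x != y ->
  exists2 v, v \in V & g v x = g v y}.

Lemma card_le_isolated_dom : #|D| <= \sum_(v in V) #|isolated D (g v)|.
Proof.
have [v0 v0V [x]] : exists2 v, v \in V & exists x, x \in isolated D (g v).
  case: (pickP [pred v | (v \in V) && (isolated D (g v) != set0)]) => [v|none].
    by case/andP=> vV /set0Pn[x xv]; exists v => //; exists x.
  have := card_le_isolated; rewrite big1 ?leqn0 ?cards_eq0 ?(negPf V_neq0) //.
  by move=> v vV; have /= := none v; rewrite vV /= => /negbFE/eqP->; rewrite cards0.
rewrite inE => /andP[xD x_iso].
pose r v := #|fiber D (g v) (g v x)|.
(* Every other element of [D] shares its value with [x] on some [v], so the fibers through [x], with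
   [x] removed, cover [D :\ x]. *)
have D_le : #|D| - 1 <= \sum_(v in V) (r v - 1).
  have sub : D :\ x \subset \bigcup_(v in V) (fiber D (g v) (g v x) :\ x).
    apply/subsetP => y; rewrite !inE => /andP[yx yD].
    have [v vV vxy] := D_meet yD xD yx.
    by apply/bigcupP; exists v => //; rewrite !inE yx yD vxy eqxx.
  have := subset_leq_card sub; rewrite (cardsD1 x D) xD add1n subn1 /=.
  move=> /leq_trans; apply.
  have -> : \sum_(v in V) (r v - 1) =
      \sum_(v in V) #|fiber D (g v) (g v x) :\ x|.
    apply: eq_bigr => v _.
    by rewrite /r (cardsD1 x (fiber _ _ _)) !inE xD eqxx addKn.
  elim/big_rec2: _ => [|v n A _ IH]; first by rewrite cards0.
  by apply: leq_trans (leq_card_setU _ _) _; rewrite leq_add2l.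
(* The excess 1 occurs only when [r v >= 2], hence not at [v0], where [x] is isolated. The total
   excess is thus at most [#|V| - 1], and this saved unit offsets the one lost in [D_le]. *)
have step : \sum_(v in V) (r v - 1 + 2 * size (values D (g v))) <=
    \sum_(v in V) ((v != v0) + (#|isolated D (g v)| + #|D|)).
  apply: leq_sum => v vV; have := double_values_le D (g v).
  case: (leqP (r v) 1) => [|rv]; first by move: (v != v0) => b; lia.
  have -> : v != v0.
    by apply: contraTneq rv => ->; rewrite -leqNgt /r (eqP x_iso).
  by have := fiber_double_values_le xD rv; rewrite -/(r v); lia.
move: step; rewrite big_split -big_distrr /= big_split big_split /= sum_nat_const.
have -> : \sum_(v in V) (v != v0) = #|V| - 1.
  rewrite (bigD1 v0) //= eqxx add0n (cardsD1 v0 V) v0V addKn -sum1_card.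
  by apply: eq_big => v; [rewrite !inE andbC | case/andP=> _ ->].
have : 0 < #|V| by apply/card_gt0P; exists v0.
lia.
Qed.

End Counting.

(** Consecutive pairs count the interior terms twice but the two end terms once, hence [B 0 + B n]
    on the left. The line at infinity, adjacent to both ends, will close the cycle. *)
Lemma sum_consecutive_ge (N n : nat) (B : nat -> nat) :
    (forall i, i < n -> N <= B i + B i.+1) ->
  N * n + B 0 + B n <= 2 * \sum_(0 <= i < n.+1) B i.
Proof.
elim: n => [|n IH] NB; first by rewrite big_nat1; lia.
rewrite big_nat_recr //= mulnS; have := NB n (ltnSn n).
have := IH (fun i lt_in => NB i (ltnW lt_in)).
set S := \sum_(0 <= i < n.+1) _; lia.
Qed.

(** * Affine graphs over vertical lines *)

Section Affine.
Variables (R : realFieldType) (I T : finType) (V : {set I}) (D : {set T}).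
Variables (v0 : I) (a : I -> R) (alpha beta : T -> R).

(* The height at which the line [y = alpha x * X + beta x] meets the vertical
   line [X = a v]; for the line at infinity [v0], its slope. *)
Definition height (v : I) (x : T) : R :=
  if v == v0 then alpha x else (beta x + a v * alpha x)%R.

Hypothesis v0V : v0 \in V.
Hypothesis V_gt1 : 1 < #|V|.
Hypothesis D_neq0 : D != set0.
Hypothesis a_inj : {in V :\ v0 &, injective a}.
Hypothesis line_inj : {in D &, forall x y,
  alpha x = alpha y -> beta x = beta y -> x = y}.
Hypothesis D_meet : {in D &, forall x y, x != y ->
  exists2 v, v \in V & height v x = height v y}.

Let hgt (c : R) (x : T) : R := (beta x + c * alpha x)%R.

Lemma hgt_meet x y : x \in D -> y \in D -> alpha x != alpha y ->
  exists2 v, v \in V :\ v0 & hgt (a v) x = hgt (a v) y.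
Proof.
move=> xD yD axy.
have [|v vV] := D_meet xD yD; first by apply: contraNneq axy => ->.
rewrite /height; case: eqP => [_ /eqP|/eqP vv0 e]; first by rewrite (negPf axy).
by exists v; rewrite // !inE vv0.
Qed.

(** If two graphs changed order from [c] to [d], they would cross at an abscissa strictly between;
    but non-parallel graphs cross at some [a v]. Two graphs agreeing at both [c] and [d]
    coincide. *)
Lemma values_consecutive_ge c d : (c < d)%R ->
    {in V :\ v0, forall v, (a v <= c)%R || (d <= a v)%R} ->
  #|D| + 1 <= size (values D (hgt c)) + size (values D (hgt d)).
Proof.
move=> cd gap; apply: card_chain_le => // x y xD yD; rewrite /hgt; last first.
  move=> e1 e2; have e : ((d - c) * (alpha x - alpha y) = 0)%R by lra.
  move/eqP: e; rewrite mulf_eq0 !subr_eq0 gt_eqF //= => /eqP e.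
  by apply: line_inj => //; move: e1; rewrite e => /addIr.
move=> lt_c; rewrite leNgt; apply/negP => lt_d.
have slope : (alpha y < alpha x)%R.
  have : (0 < (d - c) * (alpha x - alpha y))%R by lra.
  by rewrite pmulr_rgt0 ?subr_gt0.
have [v vV] := hgt_meet xD yD (negbT (gt_eqF slope)).
rewrite /hgt => e; have := gap v vV.
have : (0 < (a v - c) * (alpha x - alpha y))%R by lra.
have : (0 < (d - a v) * (alpha x - alpha y))%R by lra.
rewrite !pmulr_lgt0 ?subr_gt0 // => h1 h2.
by rewrite !leNgt h1 h2.
Qed.

(** No crossing lies to the left of [c], so the order at [c] is the one near minus infinity, by
    decreasing slope. Negating the slopes gives a chain without changing the number of values. *)
Lemma values_first_ge c : {in V :\ v0, forall v, (c <= a v)%R} ->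
  #|D| + 1 <= size (values D (hgt c)) + size (values D alpha).
Proof.
move=> cmin; rewrite -(size_values_inj D alpha (@oppr_inj R)).
apply: card_chain_le => // x y xD yD; rewrite /hgt /=; last first.
  by move=> e1 /oppr_inj e; apply: line_inj => //; move: e1; rewrite e => /addIr.
move=> lt_c; rewrite leNgt ltrN2; apply/negP => slope.
have [v vV] := hgt_meet xD yD (negbT (lt_eqF slope)).
rewrite /hgt => e; have := cmin v vV; rewrite leNgt => /negP; apply.
have : (0 < (c - a v) * (alpha y - alpha x))%R by lra.
by rewrite !pmulr_lgt0 ?subr_gt0.
Qed.

(** To the right of [c] the order is that near plus infinity, by increasing slope. *)
Lemma values_last_ge c : {in V :\ v0, forall v, (a v <= c)%R} ->
  #|D| + 1 <= size (values D (hgt c)) + size (values D alpha).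
Proof.
move=> cmax; apply: card_chain_le => // x y xD yD; rewrite /hgt /=; last first.
  by move=> e1 e; apply: line_inj => //; move: e1; rewrite e => /addIr.
move=> lt_c; rewrite leNgt; apply/negP => slope.
have [v vV] := hgt_meet xD yD (negbT (gt_eqF slope)).
rewrite /hgt => e; have := cmax v vV; rewrite leNgt => /negP; apply.
have : (0 < (a v - c) * (alpha x - alpha y))%R by lra.
by rewrite !pmulr_lgt0 ?subr_gt0.
Qed.

Lemma sum_values_height_ge :
  #|V| * (#|D| + 1) <= 2 * \sum_(v in V) size (values D (height v)).
Proof.
pose s := sort <=%R [seq a v | v in V :\ v0].
have s_uniq : uniq s.
  rewrite sort_uniq map_inj_in_uniq ?enum_uniq // => v w.
  by rewrite !mem_enum; apply: a_inj.
have s_lt : sorted <%R s by rewrite lt_sorted_uniq_le s_uniq sort_le_sorted.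
have size_s : size s = #|V| - 1.
  by rewrite size_sort size_image (cardsD1 v0 V) v0V addKn.
have mem_s v : v \in V :\ v0 -> a v \in s.
  by move=> vV; rewrite mem_sort; apply: image_f.
(* Without [v0] there are [#|V| - 1] abscissae, indexed from [0] to [n]. *)
pose n := #|V| - 2.
have size_sn : size s = n.+1 by rewrite size_s /n; lia.
pose B i := size (values D (hgt (nth 0%R s i))).
have s_lt_nth i j : i < n.+1 -> j < n.+1 -> (nth 0 s i < nth 0 s j)%R = (i < j).
  by move=> *; apply: lt_sorted_ltn_nth; rewrite ?inE ?size_sn.
have s_le_nth i j : i < n.+1 -> j < n.+1 -> (nth 0 s i <= nth 0 s j)%R = (i <= j).
  by move=> *; apply: lt_sorted_leq_nth; rewrite ?inE ?size_sn.
have index_s v : v \in V :\ v0 -> exists2 j, j < n.+1 & a v = nth 0%R s j.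
  move=> /mem_s vs; exists (index (a v) s); last by rewrite nth_index.
  by rewrite -size_sn index_mem.
have step i : i < n -> #|D| + 1 <= B i + B i.+1.
  move=> lt_in; have lt_in1 : i < n.+1 by rewrite ltnS ltnW.
  apply: values_consecutive_ge; first by rewrite s_lt_nth.
  move=> v /index_s[j jn ->].
  by rewrite !s_le_nth //; case: leqP.
have first : #|D| + 1 <= B 0 + size (values D alpha).
  by apply: values_first_ge => v /index_s[j jn ->]; rewrite s_le_nth.
have last : #|D| + 1 <= B n + size (values D alpha).
  by apply: values_last_ge => v /index_s[j jn ->]; rewrite s_le_nth.
have sumE : \sum_(v in V) size (values D (height v)) =
    size (values D alpha) + \sum_(0 <= i < n.+1) B i.
  have hE f g : f =1 g -> size (values D f) = size (values D g).
    by move=> fg; rewrite /values (eq_image (frefl _) fg).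
  rewrite (bigD1 v0) //=; congr (_ + _).
    by apply: hE => x; rewrite /height eqxx.
  rewrite (eq_bigr (fun v => size (values D (hgt (a v))))); last first.
    by move=> v /andP[_ /negPf vv0]; apply: hE => x; rewrite /height vv0.
  rewrite (eq_bigl (mem (V :\ v0))); last by move=> v; rewrite !inE andbC.
  rewrite -size_sn.
  rewrite -[RHS](big_nth 0%R xpredT (fun c => size (values D (hgt c)))).
  rewrite (perm_big [seq a v | v in V :\ v0]) ?perm_sort //=.
  by rewrite big_map big_enum.
(* Adding [first] and [last] replaces the end terms [B 0 + B n] by the two pairs that involve the
   line at infinity. *)
have := sum_consecutive_ge step.
rewrite sumE; have -> : #|V| = n.+2 by rewrite /n; lia.
lia.
Qed.

End Affine.

From mathcomp Require Import finmap.
From mathcomp Require Import boolp classical_sets cardinality reals.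

(* [point] and [form] are shadowed by the previous imports. *)
Import Defs.

Local Open Scope ring_scope.

(** * Evaluation of linear forms, and coordinates *)

Section Pairing.
Variable K : fieldType.
Implicit Types (f : 'rV[K]_3) (x : 'cV[K]_3) (p : point K).

Definition pairing f x : K := (f *m x) 0 0.

Lemma pairingDl f g x : pairing (f + g) x = pairing f x + pairing g x.
Proof. by rewrite /pairing mulmxDl mxE. Qed.

Lemma pairingDr f x y : pairing f (x + y) = pairing f x + pairing f y.
Proof. by rewrite /pairing mulmxDr mxE. Qed.

Lemma pairingZl c f x : pairing (c *: f) x = c * pairing f x.
Proof. by rewrite /pairing -scalemxAl mxE. Qed.

Lemma pairingZr c f x : pairing f (c *: x) = c * pairing f x.
Proof. by rewrite /pairing -scalemxAr mxE. Qed.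

Lemma pairingBr f x y : pairing f (x - y) = pairing f x - pairing f y.
Proof. by rewrite /pairing mulmxBr !mxE. Qed.

Lemma pairing_eq0 f x : (f *m x == 0) = (pairing f x == 0).
Proof.
apply/eqP/eqP => [|e]; first by rewrite /pairing => ->; rewrite mxE.
by apply/matrixP => i j; rewrite !ord1 [RHS]mxE.
Qed.

Lemma mem_form_line f x : (x \in form_line f) = (pairing f x == 0).
Proof. by rewrite memv_ker lfunE pairing_eq0. Qed.

Lemma form_lineZ c f : c != 0 -> form_line (c *: f) = form_line f.
Proof.
move=> c0; apply/vspaceP => x.
by rewrite !mem_form_line pairingZl mulf_eq0 (negPf c0).
Qed.

Lemma point_vline p : exists2 u, u != 0 & (p : {vspace 'cV[K]_3}) = <[u]>%VS.
Proof.
have p0 : vpick p != 0.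
  by rewrite vpick0 -dimv_eq0 (eqP (point_dim p)).
exists (vpick p) => //; apply/eqP; rewrite eq_sym eqEdim -memvE memv_pick /=.
by rewrite dim_vline p0 (eqP (point_dim p)).
Qed.

Lemma vline_point x : x != 0 -> exists p, (p : {vspace 'cV[K]_3}) = <[x]>%VS.
Proof.
move=> x0; have x1 : \dim <[x]>%VS == 1%N by rewrite dim_vline x0.
by exists (Point x1).
Qed.

Lemma lies_on_vline p x f : (p : {vspace 'cV[K]_3}) = <[x]>%VS ->
  lies_on p (form_line f) = (pairing f x == 0).
Proof. by rewrite /lies_on => ->; rewrite -memvE mem_form_line. Qed.

Lemma exists_common_zero f g :
  exists2 x, x != 0 & pairing f x = 0 /\ pairing g x = 0.
Proof.
pose B : 'M_(1 + 1, 3) := col_mx f g.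
have kB : kermx B^T != 0.
  by rewrite kermx_eq0 /row_free mxrank_tr; apply: contraTneq (rank_leq_row B) => ->.
exists (nz_row (kermx B^T))^T.
  by rewrite -(inj_eq trmx_inj) trmxK trmx0 nz_row_eq0.
have : B *m (nz_row (kermx B^T))^T = 0.
  apply: trmx_inj; rewrite trmx_mul trmxK trmx0; apply/eqP.
  by rewrite -sub_kermx nz_row_sub.
rewrite mul_col_mx => /eqP; rewrite col_mx_eq0 => /andP[].
by rewrite !pairing_eq0 => /eqP-> /eqP->.
Qed.

Lemma dim_form_line_le f : f != 0 -> (\dim (form_line f) <= 2)%N.
Proof.
move=> f0; rewrite leqNgt; apply: contra f0 => d3.
have /eqP full : form_line f == fullv.
  by rewrite eqEdim subvf dimvf /dim /= muln1.
apply/eqP/rowP => j; have : delta_mx j 0 \in form_line f by rewrite full memvf.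
rewrite mem_form_line /pairing => /eqP; rewrite -colE !mxE //.
Qed.

Lemma dim_form_line_cap_le f g : f != 0 -> g != 0 ->
  form_line f != form_line g -> (\dim (form_line f :&: form_line g) <= 1)%N.
Proof.
move=> f0 g0; apply: contraR; rewrite -ltnNge => d2.
have /eqP <- : (form_line f :&: form_line g == form_line f)%VS.
  by rewrite eqEdim capvSl (leq_trans (dim_form_line_le f0)).
by rewrite eqEdim capvSr (leq_trans (dim_form_line_le g0)).
Qed.

(* A basis [w0, w1, u] whose first two dual coordinates are [f] and [g]. *)
Lemma pencil_coordinates f g h u :
    pairing f u = 0 -> pairing g u = 0 -> pairing h u != 0 ->
    f != 0 -> (forall c, g != c *: f) ->
  exists w0 w1, [/\
    [/\ pairing f w0 = 1, pairing f w1 = 0, pairing g w0 = 0 & pairing g w1 = 1],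
    forall k, pairing k u = 0 -> k = pairing k w0 *: f + pairing k w1 *: g &
    forall x, exists t, x = pairing f x *: w0 + pairing g x *: w1 + t *: u].
Proof.
move=> fu gu hu f0 gf.
(* The vectors [w0] and [w1] will be the first two columns of the inverse of [M]. *)
pose M : 'M_(1 + (1 + 1)) := col_mx f (col_mx g h).
pose j0 : 'I_(1 + (1 + 1)) := lshift (1 + 1) 0.
pose j1 : 'I_(1 + (1 + 1)) := rshift 1 (lshift 1 0).
pose j2 : 'I_(1 + (1 + 1)) := rshift 1 (rshift 1 0).
have rowM (c : 'rV_(1 + (1 + 1))) :
    c *m M = c 0 j0 *: f + (c 0 j1 *: g + c 0 j2 *: h).
  rewrite -{1}[c]hsubmxK -{1}[rsubmx c]hsubmxK !mul_row_col.
  rewrite [lsubmx c]mx11_scalar [lsubmx (rsubmx c)]mx11_scalar.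
  by rewrite [rsubmx (rsubmx c)]mx11_scalar !mul_scalar_mx !mxE.
(* In a linear relation between the rows, evaluation at [u] kills the coefficient of [h]; then [f]
   and [g] are not proportional. *)
have Mu : M \in unitmx.
  rewrite -row_free_unit; apply: inj_row_free => c; rewrite rowM => e.
  have := congr1 (pairing^~ u) e.
  rewrite !(pairingDl, pairingZl) fu gu !mulr0 !add0r {2}/pairing mul0mx mxE.
  move=> /eqP; rewrite mulf_eq0 (negPf hu) orbF => /eqP c2.
  move: e; rewrite c2 scale0r addr0 => e.
  have c1 : c 0 j1 = 0.
    apply/eqP/negPn/negP => c1; have /eqP[] := gf (- ((c 0 j1)^-1 * c 0 j0)).
    rewrite scaleNr -scalerA; apply/eqP; rewrite -addr_eq0.
    by rewrite -{1}[g](scalerK c1) -scalerDr addrC e scaler0.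
  move: e => /eqP; rewrite c1 scale0r addr0 scaler_eq0 (negPf f0) orbF => /eqP c0.
  apply/rowP => j; rewrite mxE.
  case: (splitP j) => [i|i] ij.
    by rewrite -c0; congr (c 0 _); apply: val_inj; rewrite /= ij ord1.
  case: (splitP i) => [i'|i'] ij'.
    by rewrite -c1; congr (c 0 _); apply: val_inj; rewrite /= ij ij' ord1.
  by rewrite -c2; congr (c 0 _); apply: val_inj; rewrite /= ij ij' ord1.
pose N := invmx M.
have MN : M *m N = 1%:M by rewrite mulmxV.
have pairE k j : pairing k (col j N) = (k *m N) 0 j.
  by rewrite /pairing colE mulmxA -colE mxE.
have fE j : (f *m N) 0 j = (j0 == j)%:R.
  by rewrite -[RHS]mulr1n -[LHS](col_mxEu _ (col_mx g h *m N)) -mul_col_mx MN mxE.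
have gE j : (g *m N) 0 j = (j1 == j)%:R.
  rewrite -[LHS](col_mxEu _ (h *m N)) -mul_col_mx.
  by rewrite -[LHS](col_mxEd (f *m N)) -mul_col_mx MN mxE.
have kE k : pairing k u = 0 ->
    k = pairing k (col j0 N) *: f + pairing k (col j1 N) *: g.
  move=> ku; have e : k = (k *m N) *m M by rewrite mulmxKV.
  have := congr1 (pairing^~ u) e.
  rewrite rowM !(pairingDl, pairingZl) fu gu !mulr0 !add0r ku => /esym/eqP.
  rewrite mulf_eq0 (negPf hu) orbF => /eqP c2.
  by rewrite !pairE {1}e rowM c2 scale0r addr0.
exists (col j0 N), (col j1 N); split=> //.
  by rewrite !pairE !fE !gE.
move=> x.
pose y := x - (pairing f x *: col j0 N + pairing g x *: col j1 N).
have fy : pairing f y = 0.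
  rewrite pairingBr pairingDr !pairingZr !pairE !fE /=.
  by rewrite mulr1 mulr0 addr0 subrr.
have gy : pairing g y = 0.
  rewrite pairingBr pairingDr !pairingZr !pairE !gE /=.
  by rewrite mulr1 mulr0 add0r subrr.
exists (pairing h y / pairing h u).
(* This difference is annihilated by [f], [g] and [h], that is by the invertible [M]. *)
suff z0 : y - (pairing h y / pairing h u) *: u = 0.
  by rewrite -(subr0_eq z0) /y addrC subrK.
rewrite -[LHS]mul1mx -(mulVmx Mu) -mulmxA (_ : M *m _ = 0) ?mulmx0 //.
rewrite !mul_col_mx; apply/eqP; rewrite !col_mx_eq0 !pairing_eq0.
by rewrite !(pairingBr _ y) !pairingZr fy gy fu gu divfK // !mulr0 !subrr eqxx.
Qed.

End Pairing.

(** * Singular points and the sets of lines through them *)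

Section LinesThrough.
Variables (K : fieldType) (A : arrangement K).

Definition lines_through (q : point K) : {set 'I_(nlines A)} :=
  [set i | lies_on q (form_line (form A i))]%SET.

Lemma card_lines_through q : #|lines_through q| = multiplicity A q.
Proof. by rewrite cardsE. Qed.

Lemma form_not_proportional i j c : i != j -> form A j != c *: form A i.
Proof.
move=> ij; apply: contraNneq ij => e.
have c0 : c != 0.
  by apply: contraNneq (form_neq0 j) => c0; rewrite e c0 scale0r.
by apply/eqP/form_line_inj; rewrite e form_lineZ.
Qed.

(** A singular point is the intersection of any two distinct lines of the arrangement through it. *)
Lemma lines_through_inj : {in Sing A &, injective lines_through}.
Proof.
move=> q r; rewrite !inE /= => Sq Sr e.
have := Sq; rewrite /Sing /= -card_lines_through => /card_gt1P[i [j [qi qj ij]]].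
have := qi; have := qj; rewrite e !inE => rj ri; move: qi qj; rewrite !inE => qi qj.
have d1 : (\dim (form_line (form A i) :&: form_line (form A j)) <= 1)%N.
  apply: dim_form_line_cap_le; rewrite ?form_neq0 //.
  by apply: contraNneq ij => /form_line_inj ->.
have capE (s : point K) : lies_on s (form_line (form A i)) ->
    lies_on s (form_line (form A j)) ->
    (s : {vspace _}) = (form_line (form A i) :&: form_line (form A j))%VS.
  move=> si sj; apply/eqP; rewrite eqEdim subv_cap.
  by rewrite [(s <= _)%VS]si [(s <= _)%VS]sj (eqP (point_dim s)).
by apply: val_inj; rewrite /= (capE q) // (capE r).
Qed.

Lemma finite_Sing : finite_set (Sing A).
Proof.
have [->|/set0P[q0 _]] := eqVneq (Sing A) set0; first exact: finite_set0.
pose h (S : {set 'I_(nlines A)}) :=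
  xget q0 [set q | Sing A q /\ lines_through q = S].
apply: (@sub_finite_set _ _ (h @` [set: {set 'I_(nlines A)}])).
  move=> q Sq; exists (lines_through q) => //; rewrite /h.
  case: xgetP => [r _ [Sr e]|/(_ q)]; last by case.
  by apply: lines_through_inj; rewrite ?inE.
exact/finite_image/finite_finset.
Qed.

(** Otherwise the span of the forms, which is everything, would lie in the kernel of evaluation at
    [u], and all coordinates of [u] would vanish. *)
Lemma full_rank_not_vanishing u : full_rank A -> u != 0 ->
  exists i, pairing (form A i) u != 0.
Proof.
move=> rk u0; apply/existsP; apply: contraNT u0 => /existsPn none.
pose phi := linfun ((mulmxr u) : 'rV[K]_3 -> 'rV[K]_1).
have phiE f : (f \in lker phi) = (pairing f u == 0).
  by rewrite memv_ker lfunE /= pairing_eq0.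
have sub : (<<[seq form A i | i <- enum 'I_(nlines A)]>> <= lker phi)%VS.
  by apply/span_subvP => _ /mapP[i _ ->]; rewrite phiE; apply/negPn.
have /eqP full : lker phi == fullv.
  by rewrite eqEdim subvf dimvf /dim /= mul1n -[X in (X <= _)%N]rk dimvS.
apply/eqP/colP => j; have : delta_mx 0 j \in lker phi by rewrite full memvf.
by rewrite phiE /pairing => /eqP; rewrite -rowE !mxE.
Qed.

End LinesThrough.

(** * The affine picture around a modular point *)

Section Modular.
Variables (R : realType) (A : arrangement R) (p : point R).
Hypotheses (A_rank : full_rank A) (p_modular : modular A p).

Let n := nlines A.
Let V := lines_through A p.

(** Double points are recorded as pairs of indices, so that the count takes place in a finite type.
    A pair is determined by its point, since only its first line passes through [p]. *)
Lemma modular_double_points : exists S : {set 'I_n * 'I_n},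
  [/\ (n <= 2 * #|S|)%N,
      {in S, forall s, s.1 \in V /\ s.2 \notin V} &
      {in S, forall s, exists q, lines_through A q = [set s.1; s.2]%SET}].
Proof.
have [u u0 pu] := point_vline p.
have [p_sing p_mod] := p_modular.
have VE i : (i \in V) = (pairing (form A i) u == 0).
  by rewrite inE (lies_on_vline _ pu).
have [l0 l0u] := full_rank_not_vanishing A_rank u0.
have V_gt1 : (1 < #|V|)%N by rewrite card_lines_through.
have /card_gt1P[v0 [v1 [v0V v1V v01]]] := V_gt1.
have v0u : pairing (form A v0) u = 0 by apply/eqP; rewrite -VE.
have v1u : pairing (form A v1) u = 0 by apply/eqP; rewrite -VE.
have [w0 [w1 [[f00 f01 f10 f11] VW xW]]] :=
  pencil_coordinates v0u v1u l0u (form_neq0 v0)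
    (fun c => form_not_proportional c v01).
pose D := (~: V)%SET.
have DE i : (i \in D) = (pairing (form A i) u != 0) by rewrite inE VE.
pose c0 v := pairing (form A v) w0; pose c1 v := pairing (form A v) w1.
have formV v : v \in V -> form A v = c0 v *: form A v0 + c1 v *: form A v1.
  by rewrite VE => /eqP /VW.
(* [v0] is the line at infinity, and the line [v] is spanned by [u] and
   [w0 + a v *: w1]. *)
pose a v := - (c0 v / c1 v).
have c1_neq0 v : v \in V -> v != v0 -> c1 v != 0.
  move=> vV vv0; apply: contraNneq (form_not_proportional (c0 v) (_ : v0 != v)).
    by move=> c10; rewrite {1}(formV v vV) c10 scale0r addr0.
  by rewrite eq_sym.
have a_inj : {in (V :\ v0)%SET &, injective a}.
  move=> v w; rewrite !in_setD1 => /andP[vv0 vV] /andP[ww0 wV] /oppr_inj e.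
  apply/eqP; apply: contraT => vw.
  have cv := c1_neq0 v vV vv0; have cw := c1_neq0 w wV ww0.
  have /eqP[] := form_not_proportional (c1 w / c1 v) vw.
  rewrite (formV v vV) (formV w wV) scalerDr !scalerA divfK //; congr (_ *: _ + _).
  by rewrite mulrAC -mulrA e mulrCA divff ?mulr1.
(* Dividing by the value at [u] normalizes the form: the point of [l] over abscissa [X] is then [w0
   + X *: w1 - (beta l + X * alpha l) *: u], so heights are measured along [- u]. *)
pose alpha l := pairing (form A l) w1 / pairing (form A l) u.
pose beta l := pairing (form A l) w0 / pairing (form A l) u.
have line_inj : {in D &, forall x y, alpha x = alpha y -> beta x = beta y -> x = y}.
  move=> x y; rewrite !DE => xu yu ax bx; apply/eqP; apply: contraT => xy.
  pose c := pairing (form A y) u / pairing (form A x) u.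
  have /eqP[] := form_not_proportional c xy.
  (* With equal slopes and intercepts, this difference vanishes at [u], [w0] and [w1], hence is
     zero. *)
  have e1 : pairing (form A y - c *: form A x) u = 0.
    by rewrite -scaleNr pairingDl pairingZl mulNr divfK // subrr.
  apply/eqP; rewrite -subr_eq0 (VW _ e1); apply/eqP.
  have -> : pairing (form A y - c *: form A x) w0 = 0.
    rewrite -scaleNr pairingDl pairingZl mulNr /c mulrAC -mulrA -/(beta x) bx.
    by rewrite mulrC divfK ?subrr.
  have -> : pairing (form A y - c *: form A x) w1 = 0.
    rewrite -scaleNr pairingDl pairingZl mulNr /c mulrAC -mulrA -/(alpha x) ax.
    by rewrite mulrC divfK ?subrr.
  by rewrite !scale0r addr0.
have D_meet : {in D &, forall x y, x != y ->
    exists2 v, v \in V & height v0 a alpha beta v x = height v0 a alpha beta v y}.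
  move=> l k; rewrite !DE => lu ku lk.
  have [x x0 [lx kx]] := exists_common_zero (form A l) (form A k).
  have [q qx] := vline_point x0.
  have q_sing : Sing A q.
    rewrite /Sing /= -card_lines_through; apply/card_gt1P; exists l, k.
    by rewrite !inE !(lies_on_vline _ qx) lx kx eqxx.
  have qp : q != p.
    apply: contraNneq lu => e; rewrite -(lies_on_vline _ pu) -e.
    by rewrite (lies_on_vline _ qx) lx.
  (* Modularity enters here: the line joining [p] to the crossing point [q] belongs to the
     arrangement, hence to [V]. *)
  have [v vE] := p_mod q q_sing qp.
  have vV : v \in V by rewrite inE /lies_on vE addvSl.
  have vx : pairing (form A v) x = 0.
    by apply/eqP; rewrite -mem_form_line vE memvE -qx addvSr.
  exists v => //; have [t xE] := xW x.
  set s0 := pairing (form A v0) x in xE; set s1 := pairing (form A v1) x in xE.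
  have lE : s0 * beta l + s1 * alpha l = - t.
    move: lx; rewrite {1}xE !(pairingDr, pairingZr) => e.
    apply: (mulIf lu); rewrite mulrDl -!mulrA !mulVf // !mulr1.
    by apply/eqP; rewrite mulNr -addr_eq0 e.
  have kE : s0 * beta k + s1 * alpha k = - t.
    move: kx; rewrite {1}xE !(pairingDr, pairingZr) => e.
    apply: (mulIf ku); rewrite mulrDl -!mulrA !mulVf // !mulr1.
    by apply/eqP; rewrite mulNr -addr_eq0 e.
  (* Otherwise [lE] gives [t = 0] and then [x = 0]. *)
  have s_neq0 : ~ (s0 = 0 /\ s1 = 0).
    move=> [s00 s10]; move: lE; rewrite s00 s10 !mul0r addr0 => /esym/eqP.
    rewrite oppr_eq0 => /eqP t0; move/eqP: x0; apply.
    by rewrite xE s00 s10 t0 !scale0r !addr0.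
  have vs : c0 v * s0 + c1 v * s1 = 0.
    by move: vx; rewrite {1}(formV v vV) pairingDl !pairingZl.
  (* At infinity [s0 = 0], and [lE], [kE] compare the slopes; elsewhere [s1 = s0 * a v], and
     dividing by [s0] compares the heights at [a v]. *)
  rewrite /height; case: eqP => [vv0|/eqP vv0].
    have s00 : s0 = 0 by rewrite /s0 -vv0.
    have s10 : s1 != 0 by apply/eqP => s10; apply: s_neq0.
    by apply: (mulfI s10); move: lE kE; rewrite s00 !mul0r !add0r => -> ->.
  have cv := c1_neq0 v vV vv0.
  have s1E : s1 = s0 * a v.
    have aE : a v * c1 v = - c0 v by rewrite mulNr divfK.
    by apply: (mulfI cv); rewrite mulrCA [c1 v * a v]mulrC aE; lra.
  have s00 : s0 != 0.
    by apply/eqP => s00; apply: s_neq0; rewrite s1E s00 mul0r.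
  by apply: (mulfI s00); rewrite !mulrDr !(mulrA s0 (a v)) -s1E lE kE.
have D_neq0 : D != finset.set0 by apply/set0Pn; exists l0; rewrite DE.
have V_neq0 : V != finset.set0 by apply/set0Pn; exists v0.
have vals := sum_values_height_ge v0V V_gt1 D_neq0 a_inj line_inj D_meet.
have le_V := card_le_isolated vals.
have le_D := card_le_isolated_dom vals V_neq0 D_meet.
pose S := [set s : 'I_n * 'I_n | (s.1 \in V) &&
  (s.2 \in isolated D (height v0 a alpha beta s.1))]%SET.
exists S; split.
- have -> : #|S| = (\sum_(v in V) #|isolated D (height v0 a alpha beta v)|)%N.
    rewrite -sum1_card (eq_bigr (fun v =>
      \sum_(l in isolated D (height v0 a alpha beta v)) 1)%N); last first.
      by move=> v _; rewrite sum1_card.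
    rewrite pair_big_dep /=; apply: eq_bigl => s; rewrite inE //.
  have VD : (#|V| + #|D|)%N = n by rewrite /D cardsC card_ord.
  by rewrite -[X in (X <= _)%N]VD mul2n -addnn leq_add.
- by move=> [v l]; rewrite !inE /= => /and3P[-> + _] => /negPf->.
- move=> [v l]; rewrite inE /= => /andP[vV]; rewrite inE => /andP[lD l_iso].
  (* [W] is a vector of [v] outside the other lines of [V], and [x] is the point of [v] at the
     height of [l]. *)
  pose W := if v == v0 then w1 else w0 + a v *: w1.
  pose x := W - height v0 a alpha beta v l *: u.
  have VW_neq0 v' : v' \in V -> v' != v -> pairing (form A v') W != 0.
    move=> v'V v'v; rewrite /W; case: (eqVneq v v0) => [e|vv0].
      by apply: c1_neq0; rewrite // -e.
    rewrite pairingDr pairingZr -/(c0 v') -/(c1 v').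
    have [->|v'v0] := eqVneq v' v0.
      by rewrite /c0 /c1 f00 f01 mulr0 addr0 oner_eq0.
    have cv' := c1_neq0 v' v'V v'v0.
    apply: contra v'v => e; apply/eqP/a_inj; rewrite ?in_setD1 ?vv0 ?v'v0 //.
    apply: (mulIf cv'); rewrite /a mulNr divfK //; apply/eqP.
    by rewrite eq_sym -addr_eq0 addrC.
  have vW : pairing (form A v) W = 0.
    rewrite /W; case: (eqVneq v v0) => [->|vv0]; first exact: f01.
    rewrite pairingDr pairingZr -/(c0 v) -/(c1 v) /a mulNr divfK ?subrr //.
    exact: c1_neq0.
  have Vx v' : v' \in V -> pairing (form A v') x = pairing (form A v') W.
    by rewrite VE /x pairingBr pairingZr => /eqP->; rewrite mulr0 subr0.
  have Dx k : k \in D -> pairing (form A k) x = pairing (form A k) u *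
      (height v0 a alpha beta v k - height v0 a alpha beta v l).
    rewrite DE => ku.
    have aE : pairing (form A k) u * alpha k = pairing (form A k) w1.
      by rewrite mulrC divfK.
    have bE : pairing (form A k) u * beta k = pairing (form A k) w0.
      by rewrite mulrC divfK.
    rewrite /x pairingBr pairingZr mulrBr [X in _ - X]mulrC; congr (_ - _).
    rewrite /W /height; case: eqP => _; first by rewrite aE.
    by rewrite pairingDr pairingZr mulrDr bE mulrCA aE.
  have x0 : x != 0.
    have [w wV wv] : exists2 w, w \in V & w != v.
      by have [<-|] := eqVneq v0 v; [exists v1; rewrite // eq_sym | exists v0].
    apply: contraNneq (VW_neq0 w wV wv) => e.
    by rewrite -Vx // e /pairing mulmx0 mxE.
  have [q qx] := vline_point x0; exists q; apply/setP => i.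
  rewrite in_set2 inE (lies_on_vline _ qx).
  (* A line of [V] through [x] also contains [W], so it is [v]; a line of [D] through [x] has the
     height of [l] on [v], so it is [l] by isolation. *)
  have [iV|iD] := boolP (i \in V).
    rewrite Vx // (_ : (i == l) = false) ?orbF; last first.
      by apply: contraTF lD => /eqP<-; rewrite inE iV.
    have [->|iv] := eqVneq i v; first by rewrite vW eqxx.
    exact/negbTE/VW_neq0.
  rewrite (_ : (i == v) = false) /=; last first.
    by apply: contraNF iD => /eqP->.
  have {}iD : i \in D by rewrite inE.
  rewrite Dx // mulf_eq0 -[_ == 0]negbK -DE iD /= subr_eq0.
  apply/eqP/eqP => [e|->//].
  have /card_le1_eqP := eq_leq (eqP l_iso).
  by apply; rewrite inE ?lD ?iD ?e /=.
Qed.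

End Modular.

(** * From pairs of lines to double points *)

Theorem theorem2p4 (R : realType) (A : arrangement R)
    (hrank : full_rank A) (hsuper : supersolvable A) :
  (#|` fset_set (Sing2 A)|%:R : R) >= (nlines A)%:R / 2.
Proof.
have [p p_mod] := hsuper.
have [S [S_card SV SX]] := modular_double_points hrank p_mod.
have S_neq s : s \in S -> s.1 != s.2.
  by move=> /SV[s1 s2]; apply: contraNneq s2 => <-.
have fin2 : finite_set (Sing2 A).
  by apply: sub_finite_set (finite_Sing A) => q [].
(* The default [p] is never taken on [S], by [SX]. *)
pose X s := xget p [set q | lines_through A q = [set s.1; s.2]%SET].
have XE s : s \in S -> lines_through A (X s) = [set s.1; s.2]%SET.
  by move=> /SX[q qE]; rewrite /X; case: xgetP => // /(_ q).
have X_inj : {in S &, injective X}.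
  move=> [v l] [w k] sS tS e; have := XE _ sS; rewrite e XE //= => /setP e2.
  have [/= vV lV] := SV _ sS; have [/= wV kV] := SV _ tS.
  (* Equal unordered pairs are equal as ordered pairs: first components lie in [V], second ones do
     not. *)
  have := e2 v; have := e2 l; rewrite !in_set2 !eqxx ?orbT.
  case: eqP => [lw|_ /eqP->]; first by rewrite lw wV in lV.
  by case: eqP => [->//|_ /eqP vk]; rewrite -vk vV in kV.
have sub : ([fset X s | s in S] `<=` fset_set (Sing2 A))%fset.
  apply/fsubsetP => _ /imfsetP[s /= sS ->]; rewrite in_fset_set // inE.
  have m2 : multiplicity A (X s) = 2%N.
    by rewrite -card_lines_through XE // cards2 S_neq.
  by split=> //; rewrite /Sing /= m2.
have := fsubset_leq_card sub; rewrite card_in_imfset //= -cardE => le_S.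
rewrite ler_pdivrMr // -natrM ler_nat mulnC.
by apply: leq_trans S_card _; rewrite leq_mul2l.
Qed.
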